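(* Let $\mathcal{A}$ be a finite-dimensional evolution algebra over a field $\mathbb{K}$ with natural basis $\mathcal{B}$ and structure matrix $\mathcal{M}_{\mathcal{B}}$, let $d_2,d_3$ be linear maps on $\mathcal{A}$, and let $G$ be a generalised inverse of $\mathcal{M}_{\mathcal{B}}$. Any solution $d_1$ of the matrix equation $$d_1\mathcal{M}_{\mathcal{B}}=\mathcal{M}_{\mathcal{B}}\,\mathrm{diag}(d_2+d_3)$$ is of the form $\mathcal{M}_{\mathcal{B}}\,\mathrm{diag}(d_2+d_3)\,G+A$, where $A$ is such that $A\mathcal{M}_{\mathcal{B}}=0$.
   Context: $\mathbb{K}$ is an arbitrary field. An $n$-dimensional evolution algebra is an $n$-dimensional vector space $\mathcal{A}$ over $\mathbb{K}$ with a bilinear product admitting a basis $\mathcal{B}=\{e_1,\dots,e_n\}$ (a natural basis) such that $e_ie_j=0$ for $i\neq j$. Writing $e_i^2=\sum_{k=1}^n w_{ki}e_k$, the structure matrix is $\mathcal{M}_{\mathcal{B}}=(w_{ki})$. Linear maps are identified with their matrices with respect to $\mathcal{B}$ (the matrix $(d_{ki})$ of $d$ is given by $d(e_i)=\sum_k d_{ki}e_k$), and $\mathrm{diag}(d_2+d_3)$ is the diagonal matrix having the same diagonal entries as $d_2+d_3$. A generalised inverse of a square matrix $M$ is a matrix $G$ with $MGM=M$. *)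

(* Defs.v *)
From HB Require Import structures.
From mathcomp Require Import all_boot all_order all_algebra.

Set Implicit Arguments.
Unset Strict Implicit.
Unset Printing Implicit Defensive.

Import GRing.Theory.
Local Open Scope ring_scope.

Definition natural_basis (K : fieldType) (V : vectType K)
    (mul : {bilinear V -> V -> V}) (n : nat) (e : n.-tuple V) : Prop :=
  basis_of fullv e /\ forall i j : 'I_n, i != j -> mul e`_i e`_j = 0.

(* Column convention: e_i * e_i = \sum_k w_ki *: e_k. *)
Definition structure_mx (K : fieldType) (V : vectType K)
    (mul : {bilinear V -> V -> V}) (n : nat) (e : n.-tuple V) : 'M[K]_n :=
  \matrix_(k, i) coord e k (mul e`_i e`_i).

(* Column convention, d e_i = \sum_k d_ki *: e_k: this is the transpose of the
   library's [mxof e e d], which acts on row vectors. *)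
Definition end_mx (K : fieldType) (V : vectType K) (n : nat) (e : n.-tuple V)
    (d : 'End(V)) : 'M[K]_n :=
  \matrix_(k, i) coord e k (d e`_i).

Definition diag_part (K : fieldType) (n : nat) (M : 'M[K]_n) : 'M[K]_n :=
  diag_mx (\row_i M i i).

Definition generalised_inverse (K : fieldType) (n : nat) (M G : 'M[K]_n)
    : Prop :=
  M *m G *m M = M.

(* Main.v *)
Require Import Defs.
From HB Require Import structures.
From mathcomp Require Import all_boot all_order all_algebra.

Set Implicit Arguments.
Unset Strict Implicit.
Unset Printing Implicit Defensive.

Import GRing.Theory.
Local Open Scope ring_scope.

Theorem lemma4p6 (K : fieldType) (V : vectType K)
    (mul : {bilinear V -> V -> V}) (n : nat) (e : n.-tuple V)
    (he : natural_basis mul e) (d2 d3 : 'End(V)) (G : 'M[K]_n)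
    (hG : generalised_inverse (structure_mx mul e) G) (d1 : 'End(V)) :
  end_mx e d1 *m structure_mx mul e =
    structure_mx mul e *m diag_part (end_mx e (d2 + d3)) ->
  exists A : 'M[K]_n,
    end_mx e d1 =
      structure_mx mul e *m diag_part (end_mx e (d2 + d3)) *m G + A /\
    A *m structure_mx mul e = 0.
Proof.
move=> d1M.
(* The equation turns M diag(d2 + d3) G into d1 M G, so A is d1 (1 - M G),
   and (1 - M G) M vanishes because G is a generalised inverse of M. *)
rewrite -d1M.
exists (end_mx e d1 - end_mx e d1 *m structure_mx mul e *m G); split.
  by rewrite addrC subrK.
by rewrite mulmxBl -!mulmxA (mulmxA (structure_mx mul e)) hG subrr.
Qed.
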